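(* Let $(\mathfrak{U},\mathcal{U})$ be a measurable space, let $U$ be a random variable with values in $\mathfrak{U}$ and non-atomic law, let $f:\mathfrak{U}\to\mathbb{R}$ be measurable with $0\le f(u)\le 1$ for all $u\in\mathfrak{U}$, and let $n\ge 1$ be an integer. Let $\mathcal{B}$ and $\mathcal{C}$ be admissible partitions of $\mathfrak{U}$ (all with respect to the same $n$). If $\mathcal{C}\le_{\mathrm{ref.}}\mathcal{B}$ (that is, $\mathcal{B}$ is a refinement of $\mathcal{C}$), then $$W_{\mathrm{CS}}^{\mathcal{C}}\le_{\mathrm{st}}W_{\mathrm{CS}}^{\mathcal{B}}.$$
   Context: Fix $n$ and let $N=\{1,\dots,n\}$. An admissible partition of $\mathfrak{U}$ is a finite sequence $\mathcal{B}=(B_1,\dots,B_b)$ of pairwise disjoint measurable sets with union $\mathfrak{U}$ such that $\mathbb{P}(U\in B_i)=k_i/n$ with $k_i\in\{1,\dots,n\}$ and $\sum_i k_i=n$. A partition $\mathcal{B}^*=(B_1^*,\dots,B_b^* )$ of $N$ is associated to $\mathcal{B}$ if $|B_i^*|=k_i$ for all $i$; each admissible $\mathcal{B}$ is taken together with an associated $\mathcal{B}^*$, and for $B=B_i\in\mathcal{B}$ one writes $B^*=B_i^*$, so that $\mathbb{P}(U\in B)=|B^*|/n$. (The laws of the estimators below do not depend on which associated partition is chosen.) $\mathcal{C}\le_{\mathrm{ref.}}\mathcal{B}$ means that every set in $\mathcal{C}$ is a union of sets in $\mathcal{B}$. For $B\in\mathcal{B}$, $P_{U|B}$ denotes the conditional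 law of $U$ given $U\in B$. Let $\{V_j^B: j\in B^*, B\in\mathcal{B}\}$ be random variables with $V_j^B$ having law $P_{U|B}$, let $\{T_j: j\in N\}$ be uniform on $[0,1]$, and let all these random variables be mutually independent. Define $$S^{\mathcal{B}}=\bigcup_{B\in\mathcal{B}}\{j\in B^*: T_j\le f(V_j^B)\},\qquad W_{\mathrm{CS}}^{\mathcal{B}}=\max_{j\in S^{\mathcal{B}}}T_j,$$ with $W_{\mathrm{CS}}^{\mathcal{B}}=0$ when $S^{\mathcal{B}}=\varnothing$; $W_{\mathrm{CS}}^{\mathcal{C}}$ is defined in the same way from $\mathcal{C}$. For real random variables, $Y\le_{\mathrm{st}}X$ means $\mathbb{E}[\phi(Y)]\le\mathbb{E}[\phi(X)]$ for all non-decreasing $\phi$ (for which the expectations exist), equivalently $\mathbb{P}(Y\le t)\ge\mathbb{P}(X\le t)$ for all $t\in\mathbb{R}$. *)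

(* Defs.v *)
From HB Require Import structures.
From mathcomp Require Import all_boot all_order all_algebra.
From mathcomp Require Import all_classical all_reals all_analysis.
From mathcomp Require Import measurable_realfun.

Set Implicit Arguments.
Unset Strict Implicit.
Unset Printing Implicit Defensive.

Import Order.TTheory GRing.Theory Num.Theory.
Import numFieldNormedType.Exports.

Local Open Scope classical_set_scope.
Local Open Scope ring_scope.

Definition non_atomic d (X : measurableType d) (R : realType)
    (mu : probability X R) : Prop :=
  forall A, measurable A -> (0 < mu A)%E ->
    exists A', [/\ measurable A', A' `<=` A, (0 < mu A')%E & (mu A' < mu A)%E].

Definition cond_law d (X : measurableType d) (R : realType)
    (mu : probability X R) (B A : set X) : \bar R :=
  (mu (A `&` B) / mu B)%E.

Definition rv_sigma d d' (Om : measurableType d) (X : measurableType d')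
    (Y : Om -> X) : set (set Om) :=
  preimage_set_system setT Y measurable.

Definition mutually_independent d (Om : measurableType d) (R : realType)
    (P : probability Om R) (I : finType) (G : I -> set (set Om)) : Prop :=
  forall (J : {set I}) (E : I -> set Om), (forall i, i \in J -> G i (E i)) ->
    P (\bigcap_(i in [set` J]) E i) = (\prod_(i in J) P (E i))%E.

Definition st_le d d' (Om : measurableType d) (Om' : measurableType d')
    (R : realType) (P : probability Om R) (P' : probability Om' R)
    (Y : {RV P >-> R}) (X : {RV P' >-> R}) : Prop :=
  forall phi : R -> R, {homo phi : s t / s <= t} ->
    P.-integrable setT (EFin \o (phi \o Y)) ->
    P'.-integrable setT (EFin \o (phi \o X)) ->
    ('E_P[phi \o Y] <= 'E_P'[phi \o X])%E.

Section partitions.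
Context d (X : measurableType d) (R : realType).

Record admissible_partition (mu : probability X R) (n : nat) := {
  ap_size : nat ;
  ap_block :> 'I_ap_size -> set X ;
  ap_weight : 'I_ap_size -> nat ;
  ap_measurable : forall i, measurable (ap_block i) ;
  ap_disjoint : trivIset setT ap_block ;
  ap_cover : \bigcup_i ap_block i = setT ;
  ap_weight_bounds : forall i, (1 <= ap_weight i <= n)%N ;
  ap_prob : forall i, mu (ap_block i) = ((ap_weight i)%:R / n%:R)%:E ;
  ap_weight_sum : (\sum_i ap_weight i = n)%N }.

Context (mu : probability X R) (n : nat).

Record associated (B : admissible_partition mu n)
    (Bs : 'I_(ap_size B) -> {set 'I_n}) : Prop := {
  assoc_disjoint : forall i i', i != i' -> (Bs i :&: Bs i' = finset.set0)%SET ;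
  assoc_cover : (\bigcup_i Bs i)%SET = [set: 'I_n]%SET ;
  assoc_card : forall i, #|Bs i| = ap_weight i }.

Definition coarser (C B : admissible_partition mu n) : Prop :=
  forall i, exists J : set 'I_(ap_size B), C i = \bigcup_(j in J) B j.

End partitions.

Section conditional_sampling.
Context d d' (X : measurableType d) (Om : measurableType d') (R : realType).
Context (mu : probability X R) (P : probability Om R) (n : nat).
Context (B : admissible_partition mu n) (Bs : 'I_(ap_size B) -> {set 'I_n}).

(* Each j : 'I_n lies in exactly one Bs i, so the family V_j^B is indexed by j
   alone. *)
Record conditional_sample (V : 'I_n -> {RV P >-> X})
    (T : 'I_n -> {RV P >-> R}) : Prop := {
  cs_law : forall i j, j \in Bs i -> forall A, measurable A ->
    distribution P (V j) A = cond_law mu (B i) A ;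
  cs_uniform : forall j (A : set R), measurable A ->
    distribution P (T j) A = uniform_prob (@ltr01 R) A ;
  cs_independent : mutually_independent P
    (fun k : 'I_n + 'I_n =>
       match k with inl j => rv_sigma (V j) | inr j => rv_sigma (T j) end) }.

Context (f : {mfun X >-> R}).
Context (V : 'I_n -> {RV P >-> X}) (T : 'I_n -> {RV P >-> R}).

Definition S_CS (w : Om) : {set 'I_n} :=
  (\bigcup_i [set j in Bs i | T j w <= f (V j w)])%SET.

Definition max_on (S : {set 'I_n}) (t : 'I_n -> R) : R :=
  if [pick j in S] is Some j0 then \big[Num.max/t j0]_(j in S) t j else 0.

Definition W_CS (w : Om) : R := max_on (S_CS w) (T ^~ w).

Lemma measurable_mem_S_CS j : measurable [set w | j \in S_CS w].
Proof.
have [/bigcupP[i _ jBi]|jB] := boolP (j \in (\bigcup_i Bs i)%SET); last first.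
  rewrite (_ : [set w | _] = set0) //; apply/seteqP; split => // w /=.
  move=> /bigcupP[i _]; rewrite inE => /andP[jBi _].
  by move/negP: jB; apply; apply/bigcupP; exists i.
rewrite (_ : [set w | _] = setT `&` (fun w => T j w <= f (V j w)) @^-1` [set true]).
  apply: measurable_fun_ler => //.
  exact: measurableT_comp.
apply/seteqP; split => w /=.
  by move=> /bigcupP[i' _]; rewrite inE => /andP[_ ->].
by move=> [_ Tf]; apply/bigcupP; exists i => //; rewrite inE jBi Tf.
Qed.

Lemma measurable_S_CS S : measurable [set w | S_CS w = S].
Proof.
rewrite (_ : [set w | _] =
  \bigcap_(j in [set: 'I_n]) [set w | (j \in S_CS w) = (j \in S)]).
  apply: fin_bigcap_measurable => // j _.
  case: (j \in S); first exact: measurable_mem_S_CS.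
  rewrite (_ : [set w | _] = ~` [set w | j \in S_CS w]).
    by apply: measurableC; exact: measurable_mem_S_CS.
  by apply/seteqP; split => w /=; [move=> ->|move/negP/negbTE].
apply/seteqP; split => w /=; first by move=> <- j _.
by move=> h; apply/setP => j; exact: h.
Qed.

Lemma measurable_max_on S : measurable_fun setT (fun w => max_on S (T ^~ w)).
Proof.
rewrite /max_on; case: pickP => [j0 _|_]; last exact: measurable_cst.
under eq_fun do rewrite -big_filter.
elim: (seq.filter _ _) => [|j s ih].
  by under eq_fun do rewrite big_nil; exact: measurable_funPT.
under eq_fun do rewrite big_cons.
by apply: measurable_maxr => //; exact: measurable_funPT.
Qed.

Lemma measurable_W_CS : measurable_fun setT W_CS.
Proof.
move=> _ Y mY; rewrite setTI.
rewrite (_ : _ @^-1` _ = \bigcup_(S in [set: {set 'I_n}])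
   ([set w | S_CS w = S] `&` (fun w => max_on S (T ^~ w)) @^-1` Y)).
  apply: fin_bigcup_measurable => // S _; apply: measurableI.
    exact: measurable_S_CS.
  by rewrite -[X in measurable X]setTI; exact: measurable_max_on.
apply/seteqP; split => w /=.
  by move=> WY; exists (S_CS w).
by move=> [S _ [<-]].
Qed.

HB.instance Definition _ := isMeasurableFun.Build _ _ _ _ W_CS measurable_W_CS.

End conditional_sampling.

(* Main.v *)
From HB Require Import structures.
Require Import Defs.
From mathcomp Require Import all_boot all_order all_algebra.
From mathcomp Require Import all_classical all_reals all_analysis.
From mathcomp Require Import measurable_realfun.

Set Implicit Arguments.
Unset Strict Implicit.
Unset Printing Implicit Defensive.

Import Order.TTheory GRing.Theory Num.Theory.
Import numFieldNormedType.Exports.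

Local Open Scope classical_set_scope.
Local Open Scope ring_scope.

(** Why the theorem is true.  Fix t >= 0.  The maximum of the accepted times is
    at most t exactly when, for each j, the pair (V_j, T_j) avoids the region
    t < T_j <= f(V_j).  The pairs are independent, and for j in B_i^* the
    conditional law makes the probability of avoidance the mean over B_i of
    some function not depending on the partition.  Writing x_i for this mean,
      P(W <= t) = prod_i x_i ^ k_i.
    Merging blocks into a coarser block C_l replaces the x_i of the merged
    blocks by their average with weights k_i, raised to the power sum k_i; the
    weighted inequality between arithmetic and geometric means says that this
    can only increase the product.  Hence the distribution function of W for
    the coarser partition dominates that for the finer one.

    The proof runs this argument for all lower sets D of the line at once,
    instead of the half-lines ]-oo, t].  It costs nothing, since D contains a
    maximum of finitely many reals as soon as it contains each of them, and for
    a nondecreasing phi the sets {phi <= r} are lower sets but not always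
    closed half-lines.  [st_le_lower_set] turns the comparison of the
    probabilities of lower sets into the comparison of expectations.  If D
    misses 0, it consists of negative numbers and W is almost surely not in D
    ([W_CS_lower_set_eq0]).  If D contains 0, [prob_W_CS_lower_set] is the
    product formula; it rests on [independent_pairs] (the pairs are
    independent, not only their components) and on [pair_law] (the law of a
    pair as a conditioned product measure).  Keeping the mean over a block as
    the measure of a piece of a fixed product measure ([block_mass]) makes its
    additivity under merging the additivity of a measure, and
    [lower_set_prob_coarser] concludes by [weighted_AGM]. *)

(** * Stochastic order and lower sets *)

Definition lower_set (R : realType) (D : set R) : Prop :=
  forall s t, s <= t -> D t -> D s.

(** The expectation of phi(Y) is an integral of tail probabilities over r > 0
    minus an integral of values of the distribution function over r < 0, and
    {phi <= r} is a lower set. *)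
Lemma st_le_lower_set d d' (Om : measurableType d) (Om' : measurableType d')
    (R : realType) (P : probability Om R) (P' : probability Om' R)
    (Y : {RV P >-> R}) (X : {RV P' >-> R}) :
  (forall D : set R, measurable D -> lower_set D ->
    (P' (X @^-1` D) <= P (Y @^-1` D))%E) ->
  st_le Y X.
Proof.
move=> leXY phi phi_homo iY iX.
have mphi : measurable_fun [set: R] phi by exact: nondecreasing_measurable.
pose phiM : {mfun R >-> R} := mfun_Sub (mem_set mphi : phi \in mfun).
pose phiY : {RV P >-> R} := phiM \o Y.
pose phiX : {RV P' >-> R} := phiM \o X.
have cdf_le r : (cdf phiX r <= cdf phiY r)%E.
  apply: (leXY (phi @^-1` `]-oo, r]%classic)).
    by rewrite -[X in measurable X]setTI; exact: (mphi measurableT).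
  by move=> s t st /=; rewrite !in_itv/=; apply: le_trans; exact: phi_homo.
have -> : ('E_P[phi \o Y] = 'E_P[phiY])%E by [].
have -> : ('E_P'[phi \o X] = 'E_P'[phiX])%E by [].
rewrite !expectation_cdf_ccdf; try exact/Lfun1_integrable.
apply: leeB; apply: ge0_le_integral => //=.
- by apply: measurable_funTS; exact: ccdf_measurable.
- by apply: measurable_funTS; exact: ccdf_measurable.
- by move=> r _; rewrite !ccdf_1_cdf leeB.
- by apply: measurable_funTS; exact: cdf_measurable.
- by apply: measurable_funTS; exact: cdf_measurable.
Qed.

(** * Weighted inequality of the arithmetic and geometric means *)

(** The inequality of the means, applied to the family that repeats each x i
    k i times, indexed by the dependent pairs (i, r) with r < k i. *)
Lemma weighted_AGM (R : realFieldType) (I : finType) (P : {pred I})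
    (k : I -> nat) (x : I -> R) :
  (forall i, P i -> 0 <= x i) ->
  \prod_(i | P i) x i ^+ k i <=
    ((\sum_(i | P i) (k i)%:R * x i) / (\sum_(i | P i) k i)%:R) ^+
      (\sum_(i | P i) k i).
Proof.
move=> x0.
pose A : {pred {i : I & 'I_(k i)}} := fun u => P (tag u).
have cardA : #|A| = \sum_(i | P i) k i.
  rewrite -sum1_card.
  under [RHS]eq_bigr => i _ do rewrite -[k i]card_ord -sum1_card.
  rewrite sig_big_dep/=; apply: eq_bigl => u; by rewrite andbT.
have prodA : \prod_(u in A) x (tag u) = \prod_(i | P i) x i ^+ k i.
  under [RHS]eq_bigr => i _ do
    rewrite -[in X in _ ^+ X](card_ord (k i)) -prodr_const.
  rewrite sig_big_dep/=; apply: eq_bigl => u; by rewrite andbT.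
have sumA : \sum_(u in A) x (tag u) = \sum_(i | P i) (k i)%:R * x i.
  under [RHS]eq_bigr => i _ do
    rewrite mulr_natl -[in X in _ *+ X](card_ord (k i)) -sumr_const.
  rewrite sig_big_dep/=; apply: eq_bigl => u; by rewrite andbT.
rewrite -prodA -sumA -cardA.
apply: (leif_le (leif_AGM _)) => u; exact: x0.
Qed.

(** * Independence and laws of pairs *)

Section independent_pairs.
Context d dX dY (Om : measurableType d) (X : measurableType dX)
  (Y : measurableType dY) (R : realType) (P : probability Om R) (I : finType).
Context (V : I -> {mfun Om >-> X}) (T : I -> {mfun Om >-> Y}).
Hypothesis indep : mutually_independent P
  (fun k : I + I => match k with
     inl j => rv_sigma (V j) | inr j => rv_sigma (T j) end).

Let VT j w := (V j w, T j w).

Let measurable_VT j : measurable_fun setT (VT j).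
Proof. exact: measurable_fun_pair. Qed.

Let VTm j : {mfun Om >-> (X * Y)%type} :=
  mfun_Sub (mem_set (@measurable_VT j) : VT j \in mfun).

(** For rectangles, independence of the pairs is independence of all the
    components. *)
Lemma independent_rectangles (K : {set I}) (a : I -> set X) (b : I -> set Y) :
  (forall j, measurable (a j)) -> (forall j, measurable (b j)) ->
  P (\bigcap_(j in [set` K]) (VT j @^-1` (a j `*` b j))) =
  (\prod_(j in K) (P (V j @^-1` a j) * P (T j @^-1` b j)))%E.
Proof.
move=> ma mb.
pose E (k : I + I) := match k with
  inl j => V j @^-1` a j | inr j => T j @^-1` b j end.
pose J := [set k : I + I | match k with inl j | inr j => j \in K end]%SET.
have EJ k : k \in J -> (match k with
     inl j => rv_sigma (V j) | inr j => rv_sigma (T j) end) (E k).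
  by move=> _; case: k => j /=;
    [exists (a j) => //; rewrite setTI | exists (b j) => //; rewrite setTI].
have -> : \bigcap_(j in [set` K]) (VT j @^-1` (a j `*` b j)) =
    \bigcap_(k in [set` J]) E k.
  apply/seteqP; split=> w /= wE.
    by move=> [] j /=; rewrite finset.inE => jK; have [] := wE _ jK.
  move=> j /= jK; split.
    by apply: (wE (inl j)); rewrite /= finset.inE.
  by apply: (wE (inr j)); rewrite /= finset.inE.
rewrite (indep EJ) big_sumType big_split/=.
by congr (_ * _)%E; apply: eq_bigl => j; rewrite finset.inE.
Qed.

Lemma independent_pair_rectangle j (a : set X) (b : set Y) :
  measurable a -> measurable b ->
  P (VT j @^-1` (a `*` b)) = (P (V j @^-1` a) * P (T j @^-1` b))%E.
Proof.
move=> ma mb.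
have := @independent_rectangles [set j]%SET (fun=> a) (fun=> b)
  (fun=> ma) (fun=> mb).
rewrite finset.big_set1 => <-; congr (P _); apply/seteqP; split=> w /=.
  by move=> wab i /=; rewrite inE => /eqP ->.
by apply => /=; rewrite inE.
Qed.

(** From rectangles to arbitrary measurable sets, one index at a time: with the
    sets at the other indices fixed, both sides are finite measures in the
    remaining set and agree on rectangles, so they agree. *)
Lemma independent_pairs (A : I -> set (X * Y)) :
  (forall j, measurable (A j)) ->
  P (\bigcap_j (VT j @^-1` A j)) = (\prod_j P (VT j @^-1` A j))%E.
Proof.
move=> mA; pose rect (D : set (X * Y)) := exists a b,
  [/\ measurable a, measurable b & D = a `*` b].
have mrect D : rect D -> measurable D.
  by move=> [a [b [ma mb ->]]]; exact: measurableX.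
have rectI : setI_closed rect.
  move=> _ _ [a [b [ma mb ->]]] [a' [b' [ma' mb' ->]]].
  exists (a `&` a'), (b `&` b'); split; [exact: measurableI..|].
  by rewrite setXI.
(* The sets outside the list s are rectangles; the list grows by induction. *)
suff H (s : seq I) : forall A : I -> set (X * Y),
    (forall j, measurable (A j)) -> (forall j, j \notin s -> rect (A j)) ->
    P (\bigcap_j (VT j @^-1` A j)) = (\prod_j P (VT j @^-1` A j))%E.
  by apply: (H (index_enum I)) => // j; rewrite mem_index_enum.
elim: s => [|k s IH] {mA}A mA rA.
  have {rA}rA j : {ab : set X * set Y |
      [/\ measurable ab.1, measurable ab.2 & A j = ab.1 `*` ab.2]}.
    by apply: cid; have [//|a [b rab]] := rA j; exists (a, b).
  pose a j := (sval (rA j)).1; pose b j := (sval (rA j)).2.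
  have ma j : measurable (a j) by rewrite /a; case: (svalP (rA j)).
  have mb j : measurable (b j) by rewrite /b; case: (svalP (rA j)).
  have Aab j : A j = a j `*` b j by rewrite /a /b; case: (svalP (rA j)).
  under eq_bigr => j _ do rewrite Aab independent_pair_rectangle//.
  under eq_bigcapr => j _ do rewrite Aab.
  rewrite -(eq_bigl _ _ (@finset.in_setT I)) -independent_rectangles//.
  by congr (P _); apply: eq_bigcapl; split => j //=; rewrite inE.
pose A' D j := if j == k then D else A j.
pose F := \bigcap_(j in [set j | j != k]) (VT j @^-1` A j).
have mVT j D : measurable D -> measurable (VT j @^-1` D).
  by move=> mD; rewrite -[X in measurable X]setTI; exact: measurable_VT.
have mF : measurable F.
  by apply: fin_bigcap_measurable => [|j _]; [exact: finite_finset|exact: mVT].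
pose c := (\prod_(j | j != k) fine (P (VT j @^-1` A j))).
have c0 : 0 <= c by apply: prodr_ge0 => j _; rewrite fine_ge0.
have [m1 m1F] : exists m : {measure set (X * Y) -> \bar R},
    forall D, m D = P ((VT k @^-1` D) `&` F).
  by unshelve eexists (pushforward (mrestr P mF) (VT k));
    [exact: measurable_VT|].
pose m2 := mscale (NngNum c0) (distribution P (VTm k)).
have m1E D : m1 D = P (\bigcap_j (VT j @^-1` A' D j)).
  rewrite m1F; congr (P _); apply/seteqP; split=> w /=.
    move=> [Dw Fw] j _; rewrite /A' /=.
    by have [->|jk] := eqVneq j k; [|exact: Fw].
  move=> wA'; split; first by have := wA' k Logic.I; rewrite /A' /= eqxx.
  by move=> j /= jk; have := wA' j Logic.I; rewrite /A' /= (negbTE jk).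
have m2E D : measurable D -> m2 D = (\prod_j P (VT j @^-1` A' D j))%E.
  move=> mD; rewrite /m2 /mscale /= /distribution /pushforward.
  rewrite (bigD1 k)//= muleC.
  rewrite /A' eqxx; congr (_ * _)%E; rewrite /c -prodEFin.
  apply: eq_bigr => j jk; rewrite (negbTE jk) fineK//.
  by rewrite fin_num_measure//; exact: mVT.
have A'k : A' (A k) = A.
  by apply/funext => j; rewrite /A'; case: eqVneq => [->|].
rewrite -A'k -m1E -m2E//.
apply: (measure_unique rect (fun=> setT)) => //.
- rewrite measurable_prod_measurableType; congr (<<s _ >>).
  apply/seteqP; split => D /=.
    by move=> [a ma [b mb <-]]; exists a, b.
  by move=> [a [b [ma mb ->]]]; exists a => //; exists b.
- by move=> _; exists setT, setT; split => //; rewrite setXTT.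
- by rewrite bigcup_const.
- move=> D rD; transitivity (\prod_j P (VT j @^-1` A' D j))%E;
    last by rewrite -m2E//; exact: mrect.
  rewrite m1E.
  apply: IH => [j|j js]; rewrite /A'; case: ifPn => // jk; first exact: mrect.
  by apply: rA; rewrite inE negb_or jk.
- move=> _; rewrite m1E; apply: le_lt_trans (ltry 1).
  apply: probability_le1; apply: fin_bigcap_measurable => // j _.
  by apply: mVT; rewrite /A'; case: ifP.
Qed.

(** Conditioning the first component on B conditions the product measure on
    B x Y: both measures have the same values on rectangles. *)
Lemma pair_law (mu : probability X R) (tau : probability Y R) (B : set X) j
    (A : set (X * Y)) :
  measurable B -> (0 < mu B)%E ->
  (forall a, measurable a -> P (V j @^-1` a) = cond_law mu B a) ->
  (forall b, measurable b -> P (T j @^-1` b) = tau b) ->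
  measurable A ->
  P (VT j @^-1` A) =
    ((fine (mu B))^-1%:E * (mu \x tau) (A `&` (B `*` setT)))%E.
Proof.
move=> mB B0 lawV lawT mA.
have iB0 : 0 <= (fine (mu B))^-1 by rewrite invr_ge0 fine_ge0.
have mBT : measurable (B `*` [set: Y]) by exact: measurableX.
transitivity ((distribution P (V j) \x distribution P (T j))%E A).
  apply/esym.
  apply: (product_measure_unique (m' := distribution P (VTm j))) => //.
  by move=> a b ma mb; exact: independent_pair_rectangle.
apply: (product_measure_unique
  (m' := mscale (NngNum iB0) (mrestr (mu \x tau)%E mBT))) => //.
move=> a b ma mb.
transitivity ((fine (mu B))^-1%:E *
    (mu \x tau) ((a `*` b) `&` (B `*` setT)))%E; first by [].
rewrite -setXI setIT product_measure1E//; last exact: measurableI.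
transitivity (cond_law mu B a * tau b)%E; last by rewrite -lawV// -lawT.
rewrite /cond_law muleA; congr (_ * _)%E.
rewrite muleC; congr (_ * _)%E.
rewrite -[X in (X^-1)%E](@fineK _ (mu B)) ?fin_num_measure// inver.
case: eqP => // B00.
by move: B0; rewrite -(@fineK _ (mu B)) ?fin_num_measure// B00 ltxx.
Qed.

End independent_pairs.

Lemma fin_num_product d d' (X : measurableType d) (Y : measurableType d')
    (R : realType) (mu : probability X R) (tau : probability Y R)
    (A : set (X * Y)) :
  measurable A -> (mu \x tau)%E A \is a fin_num.
Proof.
move=> mA; apply: (@fin_num_measure _ _ _ (product_subprobability
  (mu : subprobability X R, tau : subprobability Y R))) => //.
Qed.

(** * Mass of a block *)

(** The uniform law is defined over a copy of the line that carries another
    display, hence another type of measurable spaces with the same measurable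
    sets.  Its image under the identity has the display of the random variables
    T_j. *)
Section uniform01.
Context (R : realType).
Definition from_ocitv : measurableTypeR R -> R := idfun.
Lemma measurable_from_ocitv : measurable_fun setT from_ocitv.
Proof. by move=> _ A mA; rewrite setTI. Qed.
#[local] HB.instance Definition _ := isMeasurableFun.Build _ _ _ _
  from_ocitv measurable_from_ocitv.
Definition uniform01 : probability R R :=
  distribution (uniform_prob (@ltr01 R)) (from_ocitv : {mfun _ >-> R}).
End uniform01.

(** The pairs (v, t) of a candidate and its time that do not prevent the maximum
    of the accepted times from lying in D. *)
Definition accepted_in d (X : measurableType d) (R : realType) (f : X -> R)
    (D : set R) : set (X * R) :=
  [set z | z.2 <= f z.1 -> D z.2].

Lemma measurable_accepted_in d (X : measurableType d) (R : realType)
    (f : {mfun X >-> R}) (D : set R) :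
  measurable D -> measurable (accepted_in f D).
Proof.
move=> mD.
have -> : accepted_in f D =
    ~` ((fun z : X * R => z.2 <= f z.1) @^-1` [set true]) `|` snd @^-1` D.
  apply/seteqP; split=> -[v t] /=; rewrite /accepted_in/=.
    by case: (t <= f v) => h; [right; exact: h | left].
  by move=> [h /h //|Dt _].
apply: measurableU; last first.
  by rewrite -[X in measurable X]setTI; exact: measurable_snd.
apply: measurableC; rewrite -[X in measurable X]setTI.
by apply: measurable_fun_ler => //; exact: measurableT_comp.
Qed.

(** Up to the factor mu A, this is the conditional probability, given that the
    candidate falls in A, that a pair lies in [accepted_in f D].  As the
    measure of a set it is additive in A, which the conditional probability is
    not. *)
Definition block_mass d (X : measurableType d) (R : realType)
    (mu : probability X R) (f : X -> R) (D : set R) (A : set X) : R :=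
  fine ((mu \x uniform01 R)%E (accepted_in f D `&` (A `*` setT))).

(** * Law of the maximum on lower sets *)

(** The condition D 0 accounts for the value 0 given to the maximum over the
    empty set. *)
Lemma max_on_lower_set (R : realType) n (S : {set 'I_n}) (t : 'I_n -> R)
    (D : set R) : lower_set D -> D 0 ->
  D (max_on S t) <-> (forall j, j \in S -> D (t j)).
Proof.
move=> lD D0; rewrite /max_on; case: pickP => [j0 j0S|S0]; last first.
  by split=> // _ j; rewrite S0.
split=> [Dmax j jS|DS].
  by apply: lD Dmax; exact: le_bigmax_cond.
apply: (big_ind D) => //; first exact: DS.
by move=> x y Dx Dy; case: leP.
Qed.

Section lower_set_probability.
Context d d' (X : measurableType d) (Om : measurableType d') (R : realType).
Context (mu : probability X R) (P : probability Om R) (n : nat).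
Context (B : admissible_partition mu n) (Bs : 'I_(ap_size B) -> {set 'I_n}).
Context (V : 'I_n -> {RV P >-> X}) (T : 'I_n -> {RV P >-> R}).
Context (f : {mfun X >-> R}).
Hypotheses (hBs : associated Bs) (hVT : conditional_sample Bs V T).

Lemma mem_S_CS w j : (j \in S_CS Bs f V T w) = (T j w <= f (V j w)).
Proof.
apply/bigcupP/idP => [[i _]|Tf]; first by rewrite finset.inE => /andP[].
have /bigcupP[i _ jBi] : j \in (\bigcup_i Bs i)%SET.
  by rewrite (assoc_cover hBs) finset.inE.
by exists i => //; rewrite finset.inE jBi.
Qed.

Lemma W_CS_preimage (D : set R) : lower_set D -> D 0 ->
  W_CS Bs f V T @^-1` D =
    \bigcap_j (fun w => (V j w, T j w)) @^-1` accepted_in f D.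
Proof.
move=> lD D0; apply/seteqP; split=> w /=.
  move=> /max_on_lower_set-/(_ lD D0) DS j _ /= Tf.
  by apply: DS; rewrite mem_S_CS.
move=> DS; apply/max_on_lower_set => // j; rewrite mem_S_CS => Tf.
exact: DS.
Qed.

(** A lower set that misses 0 consists of negative numbers, and the maximum can
    only be negative if some T_j is. *)
Lemma W_CS_lower_set_eq0 (D : set R) : measurable D -> lower_set D -> ~ D 0 ->
  P (W_CS Bs f V T @^-1` D) = 0%E.
Proof.
move=> mD lD D0.
have Dlt0 t : D t -> t < 0.
  by move=> Dt; rewrite ltNge; apply/negP => t0; apply: D0; exact: lD Dt.
have T0 j : P (T j @^-1` D) = 0%E.
  transitivity (uniform_prob (@ltr01 R) D); first exact: (cs_uniform hVT j mD).
  rewrite /uniform_prob integral_uniform_pdf.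
  rewrite (_ : _ `&` _ = set0) ?integral_set0//.
  apply/seteqP; split=> // t [/Dlt0 t0] /=.
  by rewrite in_itv/= leNgt t0.
have mTD j : measurable (T j @^-1` D).
  exact: measurable_funPTI.
apply: measure_negligible.
  by rewrite -[X in measurable X]setTI;
    exact: (measurable_W_CS Bs f V T measurableT mD).
apply: (@negligibleS _ _ _ _ (\big[setU/set0]_(j < n) T j @^-1` D)).
  rewrite -bigcup_seq => w /=; rewrite /W_CS /max_on.
  case: pickP => [j0 _|_ /D0//] Dm.
  exists j0; first by rewrite /= mem_index_enum.
  by apply: lD Dm; exact: bigmax_ge_id.
elim/big_ind: _ => [|A A' NA NA'|j _]; first exact: negligible_set0.
  exact: negligibleU.
by apply/negligibleP; [exact: mTD|exact: T0].
Qed.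

(** All indices in the same block of the associated partition contribute the
    same factor, so that this partition matters only through its cardinals. *)
Lemma prob_W_CS_lower_set (D : set R) : measurable D -> lower_set D -> D 0 ->
  P (W_CS Bs f V T @^-1` D) =
    (\prod_i (block_mass mu f D (B i) / ((ap_weight i)%:R / n%:R))
       ^+ ap_weight i)%:E.
Proof.
move=> mD lD D0; rewrite W_CS_preimage//.
have mA := measurable_accepted_in f mD.
rewrite (independent_pairs (cs_independent hVT))//.
pose F j := fine (P ((fun w => (V j w, T j w)) @^-1` accepted_in f D)).
transitivity (\prod_j F j)%:E.
  rewrite -prodEFin; apply: eq_bigr => j _; rewrite fineK// fin_num_measure//.
  by rewrite -[X in measurable X]setTI; apply: measurable_fun_pair.
congr EFin.
rewrite -(eq_bigl _ _ (@finset.in_setT 'I_n)) -(assoc_cover hBs).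
rewrite partition_disjoint_bigcup/=; last first.
  by move=> i i' ii'; rewrite -finset.setI_eq0 (assoc_disjoint hBs).
apply: eq_bigr => i _; rewrite -(assoc_card hBs) -prodr_const.
apply: eq_bigr => j jBi; rewrite /F.
rewrite (pair_law (cs_independent hVT)
  (mu := mu) (tau := uniform01 R) (B := B i))//.
- have mABT : measurable (accepted_in f D `&` (B i `*` setT)).
    by apply: measurableI => //; apply: measurableX => //; exact: ap_measurable.
  by rewrite fineM ?fin_num_product//= (ap_prob i) (assoc_card hBs) mulrC.
- exact: ap_measurable.
- rewrite (ap_prob i) lte_fin; have /andP[k0 kn] := ap_weight_bounds i.
  by rewrite divr_gt0// ltr0n// (leq_trans k0 kn).
- by move=> a ma; exact: (cs_law hVT jBi ma).
- by move=> b mb; exact: (cs_uniform hVT).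
Qed.

End lower_set_probability.

(** * Merging blocks *)

(** A refinement is encoded by the map that sends a block of B to the block of C
    containing it.  This map exists because each block of B, having positive
    probability, has a point, whose block in C is a union of blocks of B. *)
Lemma coarser_map d (X : measurableType d) (R : realType)
    (mu : probability X R) n (B C : admissible_partition mu n) :
  coarser C B -> exists p : 'I_(ap_size B) -> 'I_(ap_size C),
    forall l, C l = \bigcup_(i in [set i | p i = l]) B i.
Proof.
move=> CB.
have Bne i : B i !=set0.
  have /andP[k0 kn] := ap_weight_bounds (a:=B) i.
  have mB : mu (B i) != 0%E.
    rewrite (ap_prob (a:=B) i).
    rewrite eqe mulf_neq0 ?invr_eq0 ?pnatr_eq0 -?lt0n//.
    exact: leq_trans kn.
  apply/set0P/eqP => Bi0; move: mB; rewrite Bi0.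
  by rewrite measure0 eqxx.
have BC i : exists l, B i `<=` C l.
  have [x Bix] := Bne i.
  have [l _ Clx] : (\bigcup_l C l) x by rewrite ap_cover.
  exists l; have [J CJ] := CB l; rewrite CJ; apply: bigcup_sup.
  move: Clx; rewrite CJ => -[i' Ji' Bi'x].
  by rewrite (ap_disjoint (a:=B) (i:=i) (j:=i') I I)//; exists x.
have [p Bp] := choice BC; exists p => l.
apply/seteqP; split=> [x Clx|x [i /= <-]]; last exact: Bp.
have [i _ Bix] : (\bigcup_i B i) x by rewrite ap_cover.
exists i => //=; apply: (ap_disjoint (a:=C)) => //.
by exists x; split => //; exact: Bp.
Qed.

Lemma measure_bigcup_fiber d (T : measurableType d) (R : realType)
    (mu : {measure set T -> \bar R}) n m (p : 'I_n -> 'I_m)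
    (F : 'I_n -> set T) l :
  (forall i, measurable (F i)) -> trivIset setT F ->
  mu (\bigcup_(i in [set i | p i = l]) F i) = (\sum_(i | p i == l) mu (F i))%E.
Proof.
move=> mF tF; rewrite -measure_bigsetU_ord// -bigcup_seq_cond; congr (mu _).
by apply: eq_bigcupl; split=> i /=; rewrite mem_index_enum/= => /eqP.
Qed.

Section refinement.
Context d (X : measurableType d) (R : realType).
Context (mu : probability X R) (n : nat).
Context (B C : admissible_partition mu n).
Context (p : 'I_(ap_size B) -> 'I_(ap_size C)).
Hypothesis Cp : forall l, C l = \bigcup_(i in [set i | p i = l]) B i.

Lemma block_mass_fiber (f : {mfun X >-> R}) (D : set R) l : measurable D ->
  block_mass mu f D (C l) = \sum_(i | p i == l) block_mass mu f D (B i).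
Proof.
move=> mD.
have mA := measurable_accepted_in f mD.
have mBT i : measurable (accepted_in f D `&` (B i `*` setT)).
  by apply: measurableI => //; apply: measurableX => //; exact: ap_measurable.
rewrite /block_mass sum_fine; last first.
  by move=> i _; exact: fin_num_product.
congr fine.
transitivity ((mu \x uniform01 R)%E
    (\bigcup_(i in [set i | p i = l]) (accepted_in f D `&` (B i `*` setT)))).
  congr (_ _); rewrite Cp; apply/seteqP; split=> z /=.
    by move=> [Az [[i pi Biz] _]]; exists i.
  by move=> [i pi [Az [Biz _]]]; split => //; split => //; exists i.
rewrite measure_bigcup_fiber//.
move=> i j _ _ [z [[_ [Biz _]] [_ [Bjz _]]]].
by apply: (ap_disjoint (a := B)) => //; exists z.1.
Qed.

Lemma ap_weight_fiber l : (0 < n)%N ->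
  ap_weight l = (\sum_(i | p i == l) ap_weight i)%N.
Proof.
move=> n0.
have : ((ap_weight l)%:R / n%:R)%:E =
    (\sum_(i | p i == l) ((ap_weight i)%:R / n%:R)%:E)%E :> \bar R.
  rewrite -(ap_prob l) Cp.
  transitivity (\sum_(i | p i == l) mu (B i))%E.
    by apply: measure_bigcup_fiber; [exact: ap_measurable|exact: ap_disjoint].
  by apply: eq_bigr => i _; exact: ap_prob.
rewrite sumEFin -mulr_suml -natr_sum => /eqP; rewrite eqe.
rewrite (inj_eq (mulIf _)) ?invr_neq0 ?pnatr_eq0 -?lt0n//.
by rewrite eqr_nat => /eqP.
Qed.

(** Grouping the left-hand factors by the block of C that contains them, the
    claim for each block of C is the weighted inequality of the means: the
    average of the conditional probabilities of the merged blocks, with their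
    weights, is the conditional probability of the union. *)
Lemma lower_set_prob_coarser (f : {mfun X >-> R}) (D : set R) :
  measurable D ->
  \prod_i (block_mass mu f D (B i) / ((ap_weight i)%:R / n%:R)) ^+ ap_weight i
  <= \prod_l (block_mass mu f D (C l) / ((ap_weight l)%:R / n%:R))
       ^+ ap_weight l.
Proof.
move=> mD.
have mass_ge0 A : 0 <= block_mass mu f D A by rewrite fine_ge0.
have x0 i : 0 <= block_mass mu f D (B i) / ((ap_weight i)%:R / n%:R).
  by rewrite !divr_ge0.
rewrite (partition_big p xpredT)//=; apply: ler_prod => l _.
rewrite prodr_ge0/=; last by move=> i _; rewrite exprn_ge0.
have /andP[kl kn] := ap_weight_bounds (a := C) l.
have n0 : (0 < n)%N by exact: leq_trans kn.
apply: (le_trans (weighted_AGM _ _)) => [i _|]; first exact: x0.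
rewrite -ap_weight_fiber// block_mass_fiber//.
rewrite le_eqVlt; apply/orP; left; apply/eqP; congr (_ ^+ _).
rewrite [X in _ = _ * X]invf_div [RHS]mulrA; congr (_ * _).
rewrite mulr_suml.
apply: eq_bigr => i _; have /andP[ki _] := ap_weight_bounds (a := B) i.
by rewrite invf_div mulrCA [_ * (_ / _)]mulrC divfK// pnatr_eq0 -lt0n.
Qed.

End refinement.

(** * Stochastic comparison *)

Theorem theorem3p2 (R : realType)
    (dX : measure_display) (X : measurableType dX)
    (d0 : measure_display) (Om0 : measurableType d0) (P0 : probability Om0 R)
    (U : {RV P0 >-> X}) (hU : non_atomic (distribution P0 U))
    (f : {mfun X >-> R}) (hf : forall u, 0 <= f u <= 1)
    (n : nat) (hn : (1 <= n)%N)
    (B C : admissible_partition (distribution P0 U) n)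
    (Bs : 'I_(ap_size B) -> {set 'I_n}) (hBs : associated Bs)
    (Cs : 'I_(ap_size C) -> {set 'I_n}) (hCs : associated Cs)
    (dB : measure_display) (OmB : measurableType dB) (PB : probability OmB R)
    (VB : 'I_n -> {RV PB >-> X}) (TB : 'I_n -> {RV PB >-> R})
    (hB : conditional_sample Bs VB TB)
    (dC : measure_display) (OmC : measurableType dC) (PC : probability OmC R)
    (VC : 'I_n -> {RV PC >-> X}) (TC : 'I_n -> {RV PC >-> R})
    (hC : conditional_sample Cs VC TC) :
  coarser C B ->
  st_le (W_CS Cs f VC TC : {RV PC >-> R}) (W_CS Bs f VB TB : {RV PB >-> R}).
Proof.
move=> CB; apply: st_le_lower_set => D mD lD.
have [D0|D0] := pselect (D 0); last first.
  by rewrite (W_CS_lower_set_eq0 _ hB mD lD D0).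
have [p Cp] := coarser_map CB.
change (PB (W_CS Bs f VB TB @^-1` D) <= PC (W_CS Cs f VC TC @^-1` D))%E.
rewrite (prob_W_CS_lower_set f hBs hB mD lD D0).
rewrite (prob_W_CS_lower_set f hCs hC mD lD D0) lee_fin.
exact: lower_set_prob_coarser.
Qed.
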